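(* Let $M$ be a compact metric space and let $\mu\in S_{\mathcal{F}(M)}$. The following are equivalent: (i) $\mu\in\mathrm{SCD}(B_{\mathcal{F}(M)})$; (ii) $\mu\in\overline{\mathrm{conv}}\bigl(\text{str-exp}(B_{\mathcal{F}(M)})\bigr)$. In particular, $B_{\mathcal{F}(M)}$ is an SCD set if and only if $B_{\mathcal{F}(M)}=\overline{\mathrm{conv}}\bigl(\text{str-exp}(B_{\mathcal{F}(M)})\bigr)$.
   Context: $B_X$, $S_X$, $X^*$ denote the closed unit ball, the unit sphere and the topological dual of a Banach space $X$. A slice of a bounded set $A\subseteq X$ is a non-empty intersection of $A$ with an open half-space; it can be written as $S(A,x^*,\alpha)=\{x\in A:\operatorname{Re}x^*(x)>\sup_{b\in A}\operatorname{Re}x^*(b)-\alpha\}$ with $x^*\in X^*$, $\alpha>0$. Let $A\subseteq X$ be bounded and convex and $a\in A$. A countable collection $\{V_n:n\in\mathbb{N}\}$ of non-empty subsets of $A$ is determining for $a$ if $a\in\overline{\mathrm{conv}}(B)$ whenever $B\subseteq A$ intersects all the sets $V_n$. The point $a$ is an SCD point (slicely countably determined point) of $A$ if there is a sequence of slices of $A$ that is determining for $a$; $\mathrm{SCD}(A)$ is the set of all SCD points of $A$. The set $A$ is an SCD set if there is a sequence $\{S_n:n\in\mathbb{N}\}$ of slices of $A$ such that $A\subseteq\overline{\mathrm{conv}}(B)$ whenever $B\subseteq A$ intersects all the $S_n$. A point $x\in A$ is a strongly exposed point of $A$ if there is $x^*\in X^*$ with $\operatorname{Re}x^*(x)=\sup_{b\in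 A}\operatorname{Re}x^*(b)$ such that for every sequence $(x_n)\subseteq A$ with $\operatorname{Re}x^*(x_n)\to\operatorname{Re}x^*(x)$ one has $x_n\to x$ in norm; $\text{str-exp}(A)$ is the set of strongly exposed points of $A$. For a metric space $(M,d)$ with a fixed point $0\in M$, $\mathrm{Lip}_0(M)$ is the real Banach space of all Lipschitz functions $f:M\to\mathbb{R}$ with $f(0)=0$, with norm $\|f\|=\sup\{|f(x)-f(y)|/d(x,y):x\neq y\in M\}$. For $x\in M$, $\delta_x\in\mathrm{Lip}_0(M)^*$ is given by $\delta_x(f)=f(x)$. The Lipschitz-free space $\mathcal{F}(M)$ is the norm-closed linear span of $\{\delta_x:x\in M\}$ in $\mathrm{Lip}_0(M)^*$. *)

(* Defs.v *)
From HB Require Import structures.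
From mathcomp Require Import all_boot all_order all_algebra.
From mathcomp Require Import all_classical all_reals all_analysis.

Set Implicit Arguments.
Unset Strict Implicit.
Unset Printing Implicit Defensive.

Import Order.TTheory GRing.Theory Num.Theory.
Import numFieldNormedType.Exports.

Local Open Scope classical_set_scope.
Local Open Scope ring_scope.

Section SemiNormAux.
Variables (R : realType) (V : lmodType R) (N : V -> R).
Hypothesis N_ge0 : forall x, 0 <= N x.
Hypothesis N_leZ : forall a x, N (a *: x) <= `|a| * N x.

Lemma norm_scale_eq a x : N (a *: x) = `|a| * N x.
Proof.
apply/eqP; rewrite eq_le N_leZ /=.
have [->|a0] := eqVneq a 0; first by rewrite normr0 mul0r N_ge0.
have := N_leZ a^-1 (a *: x).
by rewrite scalerA mulVf// scale1r normfV mulrC ler_pdivlMr ?normr_gt0// mulrC.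
Qed.

End SemiNormAux.

(** The dual X^* of a real normed space X, with the operator norm
    sup {|f x| : |x| <= 1}. *)
Section Dual.
Variables (R : realType) (X : normedModType R).

Definition dual_pred : {pred X -> R} :=
  mem [set f : X -> R | scalar f /\ continuous f].

Lemma dual_predP (f : X -> R) : reflect (scalar f /\ continuous f) (f \in dual_pred).
Proof. by apply: (iffP idP) => [/set_mem//|h]; exact: mem_set. Qed.

Lemma bounded_dual_pred (f : X -> R) (k : R) : scalar f -> 0 <= k ->
  (forall x, `|f x| <= k * `|x|) -> f \in dual_pred.
Proof.
move=> lf k0 fk; apply/dual_predP; split => // x.
apply/cvgrPdist_le => e e0; apply/nbhs_normP.
have k1 : 0 < 1 + k by rewrite ltr_pwDl.
exists (e / (1 + k)) => /= [|y /= xy]; first by rewrite divr_gt0.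
have -> : f x - f y = f (x - y).
  by rewrite [in RHS]addrC -(scaleN1r y) lf mulN1r addrC.
apply: le_trans (fk _) _; move: xy; rewrite ltr_pdivlMr// => /ltW.
by apply: le_trans; rewrite mulrC ler_wpM2l// lerDr.
Qed.

Lemma dual_submod_closed : submod_closed dual_pred.
Proof.
split.
  apply/dual_predP; split; last by move=> x; exact: cvg_cst.
  by move=> a u v /=; rewrite mulr0 addr0.
move=> a f g /dual_predP[lf cf] /dual_predP[lg cg]; apply/dual_predP; split.
  move=> b u v.
  change (a * f (b *: u + v) + g (b *: u + v) =
    b * (a * f u + g u) + (a * f v + g v)).
  by rewrite lf lg !mulrDr !mulrA (mulrC a b) addrACA.
move=> x; apply: (@cvgD _ _ _ _ _ (fun y => a * f y) g); last exact: cg.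
by apply: cvgMr; exact: cf.
Qed.

HB.instance Definition _ := GRing.isSubmodClosed.Build _ _ dual_pred
  dual_submod_closed.

Record dual := Dual { dual_fun :> X -> R; dual_funP : dual_fun \in dual_pred }.

HB.instance Definition _ := [isSub for dual_fun].
HB.instance Definition _ := [Choice of dual by <:].
HB.instance Definition _ := [SubChoice_isSubLmodule of dual by <:].

Definition dual_norm (f : dual) : R :=
  sup [set `|f x| | x in [set x : X | `|x| <= 1]].

Lemma dual_scalar (f : dual) : scalar f.
Proof. by have /dual_predP[] := dual_funP f. Qed.

Lemma dual_continuous (f : dual) : continuous f.
Proof. by have /dual_predP[] := dual_funP f. Qed.

Lemma dualZ (f : dual) a x : f (a *: x) = a * f x.
Proof.
have f0 : f 0 = 0.
  apply: (addrI (f 0)); rewrite addr0 -[X in X + _]mul1r -dual_scalar.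
  by rewrite scale1r addr0.
by have := dual_scalar f a x 0; rewrite !addr0 f0 addr0.
Qed.

Lemma dual_ubound (f : dual) :
  has_ubound [set `|f x| | x in [set x : X | `|x| <= 1]].
Proof.
have /cvgrPdist_le/(_ 1 ltr01) := @dual_continuous f 0.
have -> : f 0 = 0 by rewrite -(scale0r 0) dualZ mul0r.
move=> /nbhs_norm0P[e /= e0 he].
exists (2 / e) => _ [x /= x1 <-].
have e20 : 0 < e / 2 by rewrite divr_gt0.
have : `|0 - f ((e / 2) *: x)| <= 1.
  apply: he => /=; rewrite normrZ gtr0_norm//.
  apply: (@le_lt_trans _ _ (e / 2)); first by rewrite ler_piMr// ltW.
  by rewrite ltr_pdivrMr// ltr_pMr// ltr1n.
rewrite sub0r normrN dualZ normrM gtr0_norm// mulrC -ler_pdivlMr//.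
by rewrite div1r invf_div.
Qed.

Lemma dual_norm_ge0 f : 0 <= dual_norm f.
Proof.
apply: le_trans (normr_ge0 (f 0)) _; apply: ub_le_sup; first exact: dual_ubound.
by exists 0 => //=; rewrite normr0.
Qed.

Lemma dual_normP (f : dual) x : `|f x| <= dual_norm f * `|x|.
Proof.
have [->|x0] := eqVneq x 0.
  by rewrite -(scale0r 0) dualZ mul0r normr0 mulr_ge0// dual_norm_ge0.
have nx : 0 < `|x| by rewrite normr_gt0.
rewrite -ler_pdivrMr//; apply: ub_le_sup; first exact: dual_ubound.
exists (`|x|^-1 *: x) => /=; first by rewrite normfZV.
by rewrite dualZ normrM gtr0_norm ?invr_gt0// mulrC.
Qed.

Lemma dual_norm_le (f : dual) k : 0 <= k ->
  (forall x, `|f x| <= k * `|x|) -> dual_norm f <= k.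
Proof.
move=> k0 fk; apply: ge_sup; first by exists `|f 0|, 0 => //=; rewrite normr0.
by move=> _ [x /= x1 <-]; apply: le_trans (fk x) _; rewrite ler_piMr.
Qed.

Lemma dual_normD f g : dual_norm (f + g) <= dual_norm f + dual_norm g.
Proof.
apply: dual_norm_le => [|x]; first by rewrite addr_ge0 ?dual_norm_ge0.
rewrite mulrDl; apply: le_trans (ler_normD _ _) _.
by rewrite lerD ?dual_normP.
Qed.

Lemma dual_normZ a f : dual_norm (a *: f) = `|a| * dual_norm f.
Proof.
apply: norm_scale_eq => [|b g]; first exact: dual_norm_ge0.
apply: dual_norm_le => [|x]; first by rewrite mulr_ge0 ?dual_norm_ge0.
by rewrite -mulrA [leLHS]normrM ler_wpM2l ?dual_normP.
Qed.

Lemma dual_norm0_eq0 f : dual_norm f = 0 -> f = 0.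
Proof.
move=> f0; apply/val_inj/funext => x /=.
by have := dual_normP f x; rewrite f0 mul0r normr_le0 => /eqP.
Qed.

HB.instance Definition _ := @Lmodule_isNormed.Build R dual
  dual_norm dual_normD dual_normZ dual_norm0_eq0.

End Dual.

Section SlicelyCountablyDetermined.
Variables (R : realType) (X : normedModType R).
Implicit Types (A B S : set X) (V : (set X)^nat) (a x : X).

Definition unit_ball : set X := [set x | `|x| <= 1].

Definition unit_sphere : set X := [set x | `|x| = 1].

Definition conv_hull B : set X := smallest (@convex_set R X) B.

Definition closed_conv_hull B : set X := closure (conv_hull B).

Definition slice A (f : dual X) (alpha : R) : set X :=
  [set x | A x /\ sup [set f b | b in A] - alpha < f x].

Definition is_slice A S :=
  S !=set0 /\ exists (f : dual X) (alpha : R), 0 < alpha /\ S = slice A f alpha.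

Definition determining A a V :=
  (forall n, V n !=set0 /\ V n `<=` A) /\
  forall B, B `<=` A -> (forall n, B `&` V n !=set0) -> closed_conv_hull B a.

Definition SCD A : set X :=
  [set a | A a /\
    exists S : (set X)^nat, (forall n, is_slice A (S n)) /\ determining A a S].

Definition SCD_set A :=
  exists S : (set X)^nat, (forall n, is_slice A (S n)) /\
    forall B, B `<=` A -> (forall n, B `&` S n !=set0) ->
      A `<=` closed_conv_hull B.

Definition str_exp A : set X :=
  [set x | A x /\ exists f : dual X,
    f x = sup [set f b | b in A] /\
    forall u : X^nat, (forall n, A (u n)) ->
      f (u n) @[n --> \oo] --> f x -> u @ \oo --> x].

End SlicelyCountablyDetermined.
Arguments unit_ball {R} X.
Arguments unit_sphere {R} X.

(** Lip_0(M), for the base point o of M. The supremum of the empty set is 0 in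
    the library, so the norm is also the right one when M = {o}. *)
Section Lip0.
Variables (R : realType) (M : metricType R) (o : M).

Definition Lip0_pred : {pred M -> R} :=
  mem [set f : M -> R | f o = 0 /\
    exists k : R, forall x y, `|f x - f y| <= k * mdist x y].

Lemma Lip0_predP (f : M -> R) : reflect
  (f o = 0 /\ exists k : R, forall x y, `|f x - f y| <= k * mdist x y)
  (f \in Lip0_pred).
Proof. by apply: (iffP idP) => [/set_mem//|h]; exact: mem_set. Qed.

Lemma Lip0_submod_closed : submod_closed Lip0_pred.
Proof.
split.
  apply/Lip0_predP; split => //; exists 0 => x y.
  by rewrite /= subrr normr0 mul0r.
move=> a f g /Lip0_predP[f0 [k fk]] /Lip0_predP[g0 [l gl]]; apply/Lip0_predP.
split; first by change (a * f o + g o = 0); rewrite f0 g0 mulr0 addr0.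
exists (`|a| * k + l) => x y.
change (`|a * f x + g x - (a * f y + g y)| <= (`|a| * k + l) * mdist x y).
rewrite opprD addrACA -mulrBr mulrDl (le_trans (ler_normD _ _))// lerD//.
by rewrite normrM -mulrA ler_wpM2l.
Qed.

HB.instance Definition _ := GRing.isSubmodClosed.Build _ _ Lip0_pred
  Lip0_submod_closed.

Record Lip0 :=
  MkLip0 { Lip0_fun :> M -> R; Lip0_funP : Lip0_fun \in Lip0_pred }.

HB.instance Definition _ := [isSub for Lip0_fun].
HB.instance Definition _ := [Choice of Lip0 by <:].
HB.instance Definition _ := [SubChoice_isSubLmodule of Lip0 by <:].

Definition Lip0_norm (f : Lip0) : R :=
  sup [set `|f z.1 - f z.2| / mdist z.1 z.2 | z in [set z : M * M | z.1 != z.2]].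

Lemma Lip0_base (f : Lip0) : f o = 0.
Proof. by have /Lip0_predP[] := Lip0_funP f. Qed.

Lemma Lip0_ubound (f : Lip0) : has_ubound
  [set `|f z.1 - f z.2| / mdist z.1 z.2 | z in [set z : M * M | z.1 != z.2]].
Proof.
have /Lip0_predP[_ [k fk]] := Lip0_funP f; exists k => _ [z /= z12 <-].
by rewrite ler_pdivrMr ?mdist_gt0.
Qed.

Lemma Lip0_norm_ge0 f : 0 <= Lip0_norm f.
Proof.
set A := [set `|f z.1 - f z.2| / mdist z.1 z.2 |
  z in [set z : M * M | z.1 != z.2]].
have [A0|/set0P[r Ar]] := eqVneq A set0; first by rewrite /Lip0_norm -/A A0 sup0.
apply: (@le_trans _ _ r).
  by case: Ar => z _ <-; rewrite divr_ge0 ?mdist_ge0.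
by apply: ub_le_sup => //; exact: Lip0_ubound.
Qed.

Lemma Lip0_normP (f : Lip0) x y : `|f x - f y| <= Lip0_norm f * mdist x y.
Proof.
have [->|xy] := eqVneq x y.
  by rewrite subrr normr0 mulr_ge0 ?mdist_ge0 ?Lip0_norm_ge0.
rewrite -ler_pdivrMr ?mdist_gt0//; apply: ub_le_sup; first exact: Lip0_ubound.
by exists (x, y).
Qed.

Lemma Lip0_norm_le (f : Lip0) k : 0 <= k ->
  (forall x y, `|f x - f y| <= k * mdist x y) -> Lip0_norm f <= k.
Proof.
move=> k0 fk; set A := [set `|f z.1 - f z.2| / mdist z.1 z.2 |
  z in [set z : M * M | z.1 != z.2]].
have [A0|/set0P A0] := eqVneq A set0; first by rewrite /Lip0_norm -/A A0 sup0.
apply: ge_sup => // _ [z /= z12 <-].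
by rewrite ler_pdivrMr ?mdist_gt0.
Qed.

Lemma Lip0_normD f g : Lip0_norm (f + g) <= Lip0_norm f + Lip0_norm g.
Proof.
apply: Lip0_norm_le => [|x y]; first by rewrite addr_ge0 ?Lip0_norm_ge0.
change (`|f x + g x - (f y + g y)| <= (Lip0_norm f + Lip0_norm g) * mdist x y).
rewrite opprD addrACA mulrDl (le_trans (ler_normD _ _))//.
by rewrite lerD ?Lip0_normP.
Qed.

Lemma Lip0_normZ a f : Lip0_norm (a *: f) = `|a| * Lip0_norm f.
Proof.
apply: norm_scale_eq => [|b g]; first exact: Lip0_norm_ge0.
apply: Lip0_norm_le => [|x y]; first by rewrite mulr_ge0 ?Lip0_norm_ge0.
change (`|b * g x - b * g y| <= `|b| * Lip0_norm g * mdist x y).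
by rewrite -mulrBr normrM -mulrA ler_wpM2l ?Lip0_normP.
Qed.

Lemma Lip0_norm0_eq0 f : Lip0_norm f = 0 -> f = 0.
Proof.
move=> f0; apply/val_inj/funext => x /=.
by have := Lip0_normP f x o; rewrite f0 mul0r Lip0_base subr0 normr_le0 => /eqP.
Qed.

HB.instance Definition _ := @Lmodule_isNormed.Build R Lip0
  Lip0_norm Lip0_normD Lip0_normZ Lip0_norm0_eq0.

End Lip0.

(** The Lipschitz-free space F(M), for the base point o of M, as a normed space
    of its own: its norm is the restriction of the norm of Lip_0(M)^*. *)
Section LipschitzFree.
Variables (R : realType) (M : metricType R) (o : M).

Definition eval_at (x : M) : Lip0 o -> R := fun f => f x.

Lemma eval_at_dual x : eval_at x \in @dual_pred R (Lip0 o).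
Proof.
apply: (@bounded_dual_pred _ _ _ (mdist x o)) => [//||f].
  exact: mdist_ge0.
by have := Lip0_normP f x o; rewrite Lip0_base subr0 mulrC.
Qed.

Definition delta (x : M) : dual (Lip0 o) := Dual (eval_at_dual x).

Definition delta_span : set (dual (Lip0 o)) :=
  [set phi | exists (n : nat) (a : 'I_n -> R) (x : 'I_n -> M),
    phi = \sum_(i < n) a i *: delta (x i)].

Definition free_pred : {pred dual (Lip0 o)} := mem (closure delta_span).

Lemma delta_span0 : delta_span 0.
Proof.
by exists 0%N, (fun=> 0), (fun=> o); rewrite big_ord0.
Qed.

Lemma delta_spanZD b phi psi :
  delta_span phi -> delta_span psi -> delta_span (b *: phi + psi).
Proof.
move=> [n [a [x ->]]] [m [c [y ->]]].
exists (n + m)%N,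
  (fun i => match fintype.split i with inl j => b * a j | inr j => c j end),
  (fun i => match fintype.split i with inl j => x j | inr j => y j end).
rewrite big_split_ord scaler_sumr; congr (_ + _); apply: eq_bigr => i _.
  by rewrite (unsplitK (inl i)) scalerA.
by rewrite (unsplitK (inr i)).
Qed.

Lemma free_submod_closed : submod_closed free_pred.
Proof.
split; first by apply/mem_set/subset_closure/delta_span0.
move=> b phi psi /set_mem cphi /set_mem cpsi; apply/mem_set.
have cF : continuous (fun z : dual (Lip0 o) * dual (Lip0 o) => b *: z.1 + z.2).
  move=> z; apply: cvgD; last exact: cvg_snd.
  by apply: cvgZr; exact: cvg_fst.
move=> U /(cF (phi, psi))[[V W] /= [Vphi Wpsi] VWU].
have [p [sp Vp]] := cphi _ Vphi; have [q [sq Wq]] := cpsi _ Wpsi.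
exists (b *: p + q); split; first exact: delta_spanZD.
exact: (VWU (p, q)).
Qed.

HB.instance Definition _ := GRing.isSubmodClosed.Build _ _ free_pred
  free_submod_closed.

Record lipschitz_free := LipschitzFree {
  free_val :> dual (Lip0 o);
  free_valP : free_val \in free_pred }.

HB.instance Definition _ := [isSub for free_val].
HB.instance Definition _ := [Choice of lipschitz_free by <:].
HB.instance Definition _ := [SubChoice_isSubLmodule of lipschitz_free by <:].

Definition free_norm (mu : lipschitz_free) : R := `|free_val mu|.

Lemma free_normD mu nu : free_norm (mu + nu) <= free_norm mu + free_norm nu.
Proof. exact: ler_normD. Qed.

Lemma free_normZ a mu : free_norm (a *: mu) = `|a| * free_norm mu.
Proof. exact: (normrZ a (free_val mu)). Qed.

Lemma free_norm0_eq0 mu : free_norm mu = 0 -> mu = 0.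
Proof. by move/normr0_eq0 => h; exact/val_inj. Qed.

HB.instance Definition _ := @Lmodule_isNormed.Build R lipschitz_free
  free_norm free_normD free_normZ free_norm0_eq0.

End LipschitzFree.

(* Main.v *)
Require Import Defs.
From HB Require Import structures.
From mathcomp Require Import all_boot all_order all_algebra.
From mathcomp Require Import all_classical all_reals all_analysis.
From mathcomp Require Import ring lra.

Import Order.TTheory GRing.Theory Num.Theory.
Import numFieldNormedType.Exports.

Local Open Scope classical_set_scope.
Local Open Scope ring_scope.

Set Implicit Arguments.
Unset Strict Implicit.
Unset Printing Implicit Defensive.

(** Write B for the unit ball of F(M) and m(u, v) for the molecule
    (delta_u - delta_v) / d(u, v). A function g of Lip_0(M) acts on F(M) as a
    functional, its value at m(u, v) is the slope of g between u and v, and its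
    norm is the supremum of these slopes.

    That (ii) implies (i) holds because F(M) is separable and every strongly
    exposed point lies in slices of arbitrarily small diameter: countably many
    slices suffice so that a set meeting all of them has every strongly exposed
    point in its closure ([str_exp_slices]).

    The converse rests on two facts. The first is a dichotomy
    ([slice_dichotomy]): a slice of B contains a strongly exposed point or
    contains molecules m(u, v) with d(u, v) as small as desired. Indeed, let the
    slice be given by g and contain no m(u, v) with d(u, v) < r. Then g attains
    its norm at some pair, by compactness of the set of pairs at distance at
    least r. Among such pairs choose (x, y) with d(x, y) least, and add to g a
    small multiple of a function whose slope is 1 at (x, y) and is 1 at (u, v)
    only when u and v lie on the metric segment from x to y. The sum attains its
    norm only at (x, y), which forces m(x, y) to be strongly exposed, and
    m(x, y) is in the slice.

    The second fact is that very short molecules are useless for approximating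
    a unit vector mu by convex combinations. If g is 1-Lipschitz, then
    max(g, g(u) + d(u, v) - d(v, .)) is 1-Lipschitz, differs from g by at most
    2 d(u, v) and has slope -1 at (u, v) ([steepen]). So, given a function of
    norm at most 1 that nearly norms mu, molecules can be chosen one after the
    other in the slices that contain short ones so that at each stage some
    function of norm at most 1 is nearly 1 at mu and nearly -1 at all the
    molecules chosen ([avoiding_sequence]). In the other slices choose strongly
    exposed points. If the sequence of slices is determining, then mu is close to
    a convex combination of the chosen points; the function found shows that the
    molecules have little weight in it, so that mu is close to the convex hull of
    the strongly exposed points ([determining_closure]).

    The statement on the whole ball follows, since a vector of B is a convex
    combination of two opposite unit vectors. *)

(** * Convex hulls and slices *)

Lemma convex_setP (R : realType) (V : lmodType R) (A : set V) :
  @convex_set R V A <->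
  forall x y t, 0 <= t <= 1 -> A x -> A y -> A (t *: x + (1 - t) *: y).
Proof.
split=> [cA x y t t01 Ax Ay|cA x y t /set_mem Ax /set_mem Ay].
  by have /andP[t0 t1] := t01; apply/set_mem/(cA x y (Itv01 t0 t1)); exact/mem_set.
apply/mem_set/(cA x y t%:num) => //.
by apply/andP; split.
Qed.

Section Hulls.
Context (R : realType) (X : normedModType R).
Implicit Types (A B : set X) (x y : X).

Lemma conv_hull_min A B : @convex_set R X A -> B `<=` A -> conv_hull B `<=` A.
Proof. by move=> cA BA; apply: smallest_sub. Qed.

Lemma conv_hull_convex B : @convex_set R X (conv_hull B).
Proof.
apply/convex_setP => x y t t01 Bx By A [cA BA].
by move/convex_setP : (cA); apply => //; [exact: Bx|exact: By].
Qed.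

Lemma closure_convex A : @convex_set R X A -> @convex_set R X (closure A).
Proof.
move=> /convex_setP cA; apply/convex_setP => x y t t01 Ax Ay U.
have cF : continuous (fun z : X * X => t *: z.1 + (1 - t) *: z.2).
  by move=> z; apply: cvgD; apply: cvgZr; [exact: cvg_fst|exact: cvg_snd].
move=> /(cF (x, y))[[V W] /= [Vx Wy] VWU].
have [p [Ap Vp]] := Ax _ Vx; have [q [Aq Wq]] := Ay _ Wy.
exists (t *: p + (1 - t) *: q); split; first exact: cA.
exact: (VWU (p, q)).
Qed.

Lemma closureP A x :
  closure A x <-> forall e, 0 < e -> exists2 y, A y & `|x - y| < e.
Proof.
split=> [cx e e0|cx U /nbhs_normP[e /= e0 eU]].
  by have [y [Ay xy]] := cx _ (nbhsx_ballx x e e0); exists y; rewrite // -ball_normE in xy.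
by have [y Ay xy] := cx e e0; exists y; split => //; exact: eU.
Qed.

Lemma unit_ball_convex : @convex_set R X (unit_ball X).
Proof.
apply/convex_setP => x y t /andP[t0 t1] /=; rewrite /unit_ball /= => x1 y1.
rewrite (le_trans (ler_normD _ _))// !normrZ !ger0_norm ?subr_ge0//.
by move: x1 y1; nra.
Qed.

Lemma closure_unit_ball : closure (unit_ball X) `<=` unit_ball X.
Proof.
move=> x /closureP cx; apply/ler_addgt0Pl => e e0.
have [y y1 /ltW xy] := cx e e0.
by rewrite -(subrK y x) (le_trans (ler_normD _ _))// lerD.
Qed.

Lemma closed_conv_hull_ball B : B `<=` unit_ball X ->
  closed_conv_hull B `<=` unit_ball X.
Proof.
move=> B1; apply: subset_trans closure_unit_ball.
exact/closure_subset/(conv_hull_min unit_ball_convex B1).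
Qed.

Lemma sub_closed_conv_hull B : B `<=` closed_conv_hull B.
Proof. by apply: subset_trans (@subset_closure _ _); exact: sub_gen_smallest. Qed.

Lemma closed_conv_hull_min A B :
  A `<=` closed_conv_hull B -> closed_conv_hull A `<=` closed_conv_hull B.
Proof.
move=> AB; rewrite [closed_conv_hull B](iffLR (closure_id _))//; last exact: closed_closure.
apply: closure_subset; apply: conv_hull_min AB.
exact/closure_convex/conv_hull_convex.
Qed.

End Hulls.

(** * The free space as a predual of Lip_0 *)

Section FreeSpace.
Context (R : realType) (M : metricType R) (o : M).
Notation F := (lipschitz_free o).
Notation L := (Lip0 o).
Implicit Types (mu nu : F) (g h : L) (x y u v : M).

Lemma freeD mu nu g : (mu + nu) g = mu g + nu g. Proof. by []. Qed.
Lemma freeN mu g : (- mu) g = - mu g. Proof. by []. Qed.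
Lemma freeB mu nu g : (mu - nu) g = mu g - nu g. Proof. by []. Qed.
Lemma freeZ a mu g : (a *: mu) g = a * mu g. Proof. by []. Qed.
Lemma free0 g : (0 : F) g = 0. Proof. by []. Qed.

Lemma free_appD mu g h : mu (g + h) = mu g + mu h.
Proof. by rewrite -{1}[g]scale1r dual_scalar mul1r. Qed.

Lemma free_appZ mu a g : mu (a *: g) = a * mu g.
Proof. exact: dualZ. Qed.

Lemma free_appN mu g : mu (- g) = - mu g.
Proof. by rewrite -scaleN1r free_appZ mulN1r. Qed.

Lemma free_appB mu g h : mu (g - h) = mu g - mu h.
Proof. by rewrite free_appD free_appN. Qed.

Lemma free_norm_app mu g : `|mu g| <= `|mu| * `|g|.
Proof. exact: (dual_normP (free_val mu) g). Qed.

Lemma free_app_ball mu g : unit_ball F mu -> mu g <= `|g|.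
Proof.
move=> mu1; rewrite (le_trans (ler_norm _))// (le_trans (free_norm_app _ _))//.
by rewrite ler_piMl.
Qed.

Lemma free_app_norm_le mu g : `|g| <= 1 -> mu g <= `|mu|.
Proof.
move=> g1; rewrite (le_trans (ler_norm _))// (le_trans (free_norm_app _ _))//.
by rewrite ler_piMr.
Qed.

Lemma free_norm_le mu k : (forall g, `|g| <= 1 -> mu g <= k) -> `|mu| <= k.
Proof.
move=> muk; change (dual_norm (free_val mu) <= k); apply: ge_sup.
  by exists `|mu 0|, 0 => //=; rewrite normr0.
move=> _ [g /= g1 <-]; rewrite ler_norml; apply/andP; split; last exact: muk.
by rewrite lerNl -free_appN muk// normrN.
Qed.

Lemma free_norm_adherent mu e : 0 < e ->
  exists2 g, `|g| <= 1 & `|mu| - e < mu g.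
Proof.
move=> e0; apply: contrapT => H.
suff : `|mu| <= `|mu| - e by rewrite leNgt gtrBl e0.
by apply: free_norm_le => g g1; rewrite leNgt; apply/negP => ?; apply: H; exists g.
Qed.

Lemma Lip0_lip g x y : g x - g y <= `|g| * mdist x y.
Proof. exact: le_trans (ler_norm _) (Lip0_normP g x y). Qed.

Lemma Lip0_norm_leW g k : 0 <= k -> (forall x y, g x - g y <= k * mdist x y) ->
  `|g| <= k.
Proof.
move=> k0 gk; apply: Lip0_norm_le => // x y; rewrite ler_norml gk andbT.
by rewrite lerNl opprB metric_sym.
Qed.

Lemma Lip0_of (f : M -> R) k : (forall x y, f x - f y <= k * mdist x y) ->
  exists g : L, forall x, g x = f x - f o.
Proof.
move=> fk; have gP : (fun x => f x - f o) \in Lip0_pred o.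
  apply/Lip0_predP; rewrite subrr; split => //; exists k => x y.
  have -> : f x - f o - (f y - f o) = f x - f y by ring.
  by rewrite ler_norml fk andbT lerNl opprB metric_sym.
by exists (MkLip0 gP).
Qed.

Lemma delta_free x : Defs.delta o x \in @free_pred R M o.
Proof.
apply/mem_set/subset_closure; exists 1%N, (fun=> 1), (fun=> x).
by rewrite big_ord1 scale1r.
Qed.

Definition fdelta x : F := LipschitzFree (delta_free x).

Lemma fdeltaE x g : fdelta x g = g x. Proof. by []. Qed.

Lemma fdelta_dist x y : `|fdelta x - fdelta y| <= mdist x y.
Proof.
apply: free_norm_le => g g1; rewrite freeB !fdeltaE (le_trans (Lip0_lip _ _ _))//.
by rewrite ler_piMl// mdist_ge0.
Qed.

Lemma fdelta_span_dense mu e : 0 < e ->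
  exists n (a : 'I_n -> R) (x : 'I_n -> M), `|mu - \sum_(i < n) a i *: fdelta (x i)| < e.
Proof.
move=> e0; have /closureP/(_ e e0)[p [n [a [x ->]]] mup] := set_mem (free_valP mu).
exists n, a, x.
have sE : free_val (\sum_(i < n) a i *: fdelta (x i)) = \sum_(i < n) a i *: Defs.delta o (x i).
  by elim/big_ind2 : _ => // p1 q1 p2 q2 <- <-.
by rewrite -sE in mup; exact: mup.
Qed.

Definition molecule u v : F := (mdist u v)^-1 *: (fdelta u - fdelta v).

Lemma moleculeE u v g : molecule u v g = (g u - g v) / mdist u v.
Proof. by rewrite freeZ freeB !fdeltaE mulrC. Qed.

Lemma moleculeC u v : molecule v u = - molecule u v.
Proof. by rewrite /molecule metric_sym -scalerN opprB. Qed.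

Lemma molecule_ball u v : unit_ball F (molecule u v).
Proof.
have [->|uv] := eqVneq u v.
  by rewrite /unit_ball /molecule /= subrr scaler0 normr0.
rewrite /unit_ball /= normrZ ger0_norm ?invr_ge0 ?mdist_ge0//.
by rewrite mulrC ler_pdivrMr ?mdist_gt0// mul1r fdelta_dist.
Qed.

Lemma eval_free_dual g : (fun mu : F => mu g) \in @dual_pred R F.
Proof.
apply: (@bounded_dual_pred _ _ _ `|g|) => // mu.
by rewrite mulrC free_norm_app.
Qed.

Definition eval_free g : dual F := Dual (eval_free_dual g).

Lemma eval_freeE g mu : eval_free g mu = mu g. Proof. by []. Qed.

Lemma dual_norm_app (X : normedModType R) (f : dual X) (x : X) :
  `|f x| <= `|f| * `|x|.
Proof. exact: dual_normP. Qed.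

Lemma dualB (X : normedModType R) (f : dual X) (x y : X) : f (x - y) = f x - f y.
Proof. by rewrite addrC -scaleN1r dual_scalar mulN1r addrC. Qed.

Lemma dualD (X : normedModType R) (f : dual X) (x y : X) : f (x + y) = f x + f y.
Proof. by rewrite -{1}[x]scale1r dual_scalar mul1r. Qed.

Lemma dual_sum (X : normedModType R) (f : dual X) n (x : 'I_n -> X) :
  f (\sum_(i < n) x i) = \sum_(i < n) f (x i).
Proof.
elim/big_ind2 : _ => // [|a b c d <- <-]; last exact: dualD.
by rewrite -(subrr 0) dualB subrr.
Qed.

(** Every functional on F(M) is the evaluation at the Lipschitz function
    x |-> f (delta_x): both are continuous and agree on the dense span of the
    evaluation functionals. *)
Lemma dual_free_eval (f : dual F) : exists g, forall mu, f mu = mu g.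
Proof.
have [g gE] : exists g : L, forall x, g x = f (fdelta x) - f (fdelta o).
  apply: (@Lip0_of _ `|f|) => x y; rewrite -dualB.
  rewrite (le_trans (ler_norm _))// (le_trans (dual_norm_app _ _))//.
  by rewrite ler_wpM2l// fdelta_dist.
have d0 : fdelta o = 0.
  by apply/eqP; rewrite -normr_le0 free_norm_le// => h _; rewrite fdeltaE Lip0_base.
have f0 : f 0 = 0 by rewrite -[0]subr0 dualB subrr.
exists g => mu; apply/eqP; rewrite -subr_eq0 -normr_le0; apply/ler_addgt0Pl => e e0.
have k0 : 0 < `|f| + `|g| + 1 by rewrite ltr_wpDl// addr_ge0.
have [n [a [x mup]]] := fdelta_span_dense mu (divr_gt0 e0 k0).
set p := \sum_(i < n) _ in mup.
have fp : f p = p g.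
  rewrite -eval_freeE !dual_sum; apply: eq_bigr => i _.
  by rewrite !dualZ eval_freeE fdeltaE gE d0 f0 subr0.
have -> : f mu - mu g = f (mu - p) - (mu - p) g.
  by rewrite dualB freeB fp; ring.
rewrite addr0 (le_trans (ler_normB _ _))//.
rewrite (le_trans (lerD (dual_norm_app _ _) (free_norm_app _ _)))//.
rewrite [X in _ + X]mulrC -mulrDl; apply: (@le_trans _ _ ((`|f| + `|g| + 1) * `|mu - p|)).
  by rewrite ler_wpM2r// lerDl.
by rewrite mulrC -ler_pdivlMr// ltW.
Qed.

End FreeSpace.

(** Values of functionals and norms enter the linear arithmetic as atoms: they must
    not be unfolded into ring operations. *)
Ltac alra :=
  repeat match goal with
  | H : is_true (_ <= _) |- _ => revert H
  | H : is_true (_ < _) |- _ => revert H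
  | H : @eq _ _ _ |- _ => revert H
  end;
  repeat match goal with
  | |- context [@Num.norm ?A ?B ?x] => generalize (@Num.norm A B x); intro
  | |- context [@dual_fun ?A ?B ?f ?x] => generalize (@dual_fun A B f x); intro
  end; intros; lra.

(** * Strongly exposed molecules *)

Section StronglyExposedMolecules.
Context (R : realType) (M : metricType R) (o : M).
Notation F := (lipschitz_free o).
Notation L := (Lip0 o).
Implicit Types (mu nu : F) (g h : L) (x y u v : M).

(** Nonnegativity of [k] comes from the pair (x, y): its two orders give opposite
    slopes. *)
Lemma Lip0_norm_molecule g k x y : x != y ->
  (forall u v, u != v -> molecule o u v g <= k) -> `|g| <= k.
Proof.
move=> xy gk; have k0 : 0 <= k.
  have := gk x y xy; have := gk y x; rewrite eq_sym xy => /(_ isT).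
  by rewrite moleculeC freeN; alra.
apply: Lip0_norm_leW => // u v; have [->|uv] := eqVneq u v.
  by rewrite subrr mdistxx mulr0.
by rewrite -ler_pdivrMr ?mdist_gt0// -moleculeE gk.
Qed.

Lemma molecule_scale u v : mdist u v *: molecule o u v = fdelta o u - fdelta o v.
Proof.
have [->|uv] := eqVneq u v; first by rewrite subrr mdistxx scale0r.
by rewrite scalerA divff ?scale1r// gt_eqF// mdist_gt0.
Qed.

Lemma mdist_sub u v x y :
  `|mdist x y - mdist u v| <= mdist u x + mdist v y.
Proof.
have t1 := metric_triangle x u y; have t2 := metric_triangle u v y.
have t3 := metric_triangle u x v; have t4 := metric_triangle x y v.
rewrite (metric_sym x u) in t1; rewrite (metric_sym y v) in t4.
by rewrite ler_norml; apply/andP; split; alra.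
Qed.

Lemma molecule_dist u v x y : x != y ->
  `|molecule o u v - molecule o x y| <=
  2 * (mdist u x + mdist v y) / mdist x y.
Proof.
move=> xy; have D0 : 0 < mdist x y by rewrite mdist_gt0.
rewrite ler_pdivlMr// -[X in _ * X](gtr0_norm D0) mulrC -normrZ scalerBr.
rewrite molecule_scale -[mdist x y](subrK (mdist u v)) scalerDl molecule_scale.
have -> : (mdist x y - mdist u v) *: molecule o u v + (fdelta o u - fdelta o v) -
    (fdelta o x - fdelta o y) = (mdist x y - mdist u v) *: molecule o u v +
    ((fdelta o u - fdelta o x) - (fdelta o v - fdelta o y)).
  by rewrite -addrA !opprB; congr (_ + _); rewrite addrACA [RHS]addrACA; congr (_ + _); rewrite addrC.
set A := fdelta o u - fdelta o x; set B := fdelta o v - fdelta o y.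
have nAB : `|(mdist x y - mdist u v) *: molecule o u v + (A - B)| <=
    `|mdist x y - mdist u v| + (`|A| + `|B|).
  rewrite (le_trans (ler_normD _ _))// lerD ?ler_normB// normrZ.
  by rewrite ler_piMr// molecule_ball.
have nA : `|A| <= mdist u x := fdelta_dist o u x.
have nB : `|B| <= mdist v y := fdelta_dist o v y.
have D_uv := mdist_sub u v x y.
by apply: (le_trans nAB); move: nA nB D_uv; move: `|A| `|B| => a b; lra.
Qed.

(** Strong exposure of [molecule o x y] by [g], tested on molecules only. *)
Definition peak g x y :=
  (forall u v, u != v -> molecule o u v g <= molecule o x y g) /\
  forall rho, 0 < rho -> exists2 eta, 0 < eta & forall u v, u != v ->
    molecule o x y g - eta < molecule o u v g ->
    mdist u x < rho /\ mdist v y < rho.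

(** The norm of Lip_0(M) has the derivative h |-> (slope of h at (x, y)) at [g],
    uniformly in [h]: the pairs whose slope for [g] is nearly maximal are close to
    (x, y), hence have nearly the same slope for [h], and the other pairs stay
    below the bound when [s] is small. *)
Lemma peak_norm_expansion g x y e : x != y -> peak g x y -> 0 < e ->
  exists2 s, 0 < s & forall h, `|h| <= 1 ->
    `|g + s *: h| <= molecule o x y g + s * molecule o x y h + s * e.
Proof.
move=> xy [gmax gpeak] e0; have D0 : 0 < mdist x y by rewrite mdist_gt0.
(* By molecule_dist, within this radius molecules are at distance at most e. *)
have [eta eta0 near] := gpeak (e * mdist x y / 4) ltac:(by rewrite divr_gt0// mulr_gt0).
exists (eta / 2) => [|h h1]; first by rewrite divr_gt0.
set s := eta / 2; have s0 : 0 < s by rewrite divr_gt0.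
apply: (Lip0_norm_molecule xy) => u v uv; rewrite free_appD free_appZ.
have h_le1 p q : molecule o p q h <= 1.
  by rewrite (le_trans (free_app_ball _ (molecule_ball _ p q))).
have [far|/(near _ _ uv)[ux vy]] := lerP (molecule o u v g) (molecule o x y g - eta).
  have : s * (molecule o u v h - molecule o x y h) <= s * 2.
    rewrite ler_pM2l//; have := h_le1 u v; have := h_le1 y x.
    by rewrite moleculeC freeN; alra.
  have : 0 < s * e by rewrite mulr_gt0.
  have : s * 2 = eta by rewrite /s; field.
  by rewrite mulrBr; alra.
have : s * (molecule o u v h - molecule o x y h) <= s * e.
  rewrite ler_pM2l// -freeB (le_trans (free_app_norm_le _ h1))//.
  rewrite (le_trans (molecule_dist _ _ xy))// ler_pdivrMr//; alra.
have := gmax u v uv.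
by rewrite mulrBr; alra.
Qed.

(** An argument of Smulian: for [mu] in the ball, [mu (g + s *: h)] is at most
    the norm of [g + s *: h]; when [mu g] is nearly maximal,
    [peak_norm_expansion] then bounds [mu h] by nearly the slope of [h] at
    (x, y). *)
Lemma peak_str_exp g x y : x != y -> peak g x y ->
  str_exp (unit_ball F) (molecule o x y).
Proof.
move=> xy gpeak; split; first exact: molecule_ball.
have g_le : `|g| <= molecule o x y g.
  by apply: (Lip0_norm_molecule xy); exact: gpeak.1.
exists (eval_free g); split => [|w w1 fw].
  apply/eqP; rewrite eq_le; apply/andP; split.
    apply: ub_le_sup; last by exists (molecule o x y) => //; exact: molecule_ball.
    by exists `|g| => _ [b /= b1 <-]; exact: free_app_ball.
  apply: ge_sup; first by exists 0, 0 => //=; rewrite /unit_ball /= normr0.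
  by move=> _ [b /= b1 <-]; apply: le_trans g_le; exact: free_app_ball.
apply/cvgrPdist_lt => e e0; have e40 : 0 < e / 4 by rewrite divr_gt0.
have [s s0 sh] := peak_norm_expansion xy gpeak e40.
move/cvgrPdist_lt : fw => /(_ _ (mulr_gt0 s0 e40)); apply: filterS => n.
rewrite !eval_freeE => /ltr_normlW wn.
apply: (@le_lt_trans _ _ (e / 2)); last by alra.
rewrite distrC; apply: free_norm_le => h h1; rewrite freeB.
rewrite -(ler_pM2l s0) mulrBr.
have := free_app_ball (g + s *: h) (w1 n).
rewrite free_appD free_appZ => /le_trans/(_ (sh h h1)).
by have -> : s * (e / 2) = s * (e / 4) + s * (e / 4) by [field|]; alra.
Qed.

End StronglyExposedMolecules.

(** * Slices of the unit ball over a compact metric space *)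

Section Slices.
Context (R : realType) (M : metricType R) (o : M).
Notation F := (lipschitz_free o).
Notation L := (Lip0 o).
Implicit Types (mu nu : F) (g h : L) (x y u v : M).

Lemma pair_lipschitz_continuous (f : M * M -> R) k :
  (forall p q, f p - f q <= k * (mdist p.1 q.1 + mdist p.2 q.2)) ->
  continuous f.
Proof.
move=> fk p; apply/cvgrPdist_lt => e e0.
have k0 : 0 < 2 * (`|k| + 1) by rewrite mulr_gt0// ltr_wpDl.
have r0 : 0 < e / (2 * (`|k| + 1)) by rewrite divr_gt0.
set r := e / _ in r0.
exists (ball p.1 r, ball p.2 r); first by split; exact: nbhsx_ballx.
move=> q [/=]; rewrite !ballEmdist /= => q1 q2.
apply: (@le_lt_trans _ _ (`|k| * (mdist p.1 q.1 + mdist p.2 q.2))).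
  have kk : forall d : R, 0 <= d -> k * d <= `|k| * d.
    by move=> d d0; rewrite ler_wpM2r// ler_norm.
  rewrite ler_norml; apply/andP; split; last first.
    by rewrite (le_trans (fk p q))// kk// addr_ge0// mdist_ge0.
  rewrite lerNl opprB (le_trans (fk q p))// (metric_sym q.1) (metric_sym q.2).
  by rewrite kk// addr_ge0// mdist_ge0.
apply: (@le_lt_trans _ _ ((`|k| + 1) * (mdist p.1 q.1 + mdist p.2 q.2))).
  by rewrite ler_wpM2r ?lerDl// addr_ge0// mdist_ge0.
rewrite mulrC -ltr_pdivlMr ?ltr_wpDl//.
have -> : e / (`|k| + 1) = r + r by rewrite /r; field; rewrite gt_eqF// ltr_wpDl.
exact: ltrD.
Qed.

Lemma mdist_continuous : continuous (fun p : M * M => mdist p.1 p.2).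
Proof.
apply: (@pair_lipschitz_continuous _ 1) => p q; rewrite mul1r.
by rewrite (le_trans (ler_norm _))// distrC; exact: mdist_sub.
Qed.

Lemma mdist_to_pair_continuous x y :
  continuous (fun p : M * M => mdist p.1 x + mdist p.2 y).
Proof.
apply: (@pair_lipschitz_continuous _ 1) => p q; rewrite mul1r.
have := metric_triangle p.1 q.1 x; have := metric_triangle p.2 q.2 y.
by lra.
Qed.

Lemma increment_continuous g : continuous (fun p : M * M => g p.1 - g p.2).
Proof.
apply: (@pair_lipschitz_continuous _ `|g|) => p q; rewrite mulrDr.
have := Lip0_lip g p.1 q.1; have := Lip0_lip g q.2 p.2.
by rewrite (metric_sym q.2); lra.
Qed.

Lemma slope_continuous g p : p.1 != p.2 ->
  {for p, continuous (fun q : M * M => molecule o q.1 q.2 g)}.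
Proof.
move=> p12.
have -> : (fun q : M * M => molecule o q.1 q.2 g) =
    (fun q => (g q.1 - g q.2) * (mdist q.1 q.2)^-1).
  by apply/funext => q; rewrite moleculeE.
apply: (@cvgM _ _ _ _ (fun q : M * M => g q.1 - g q.2)).
  exact: increment_continuous.
by apply: cvgV; [rewrite gt_eqF// mdist_gt0|exact: mdist_continuous].
Qed.

Lemma closed_superlevel (T : topologicalType) (f : T -> R) r :
  continuous f -> closed [set p | r <= f p].
Proof.
move=> cf; apply: (@closed_comp _ _ f [set t | r <= t]).
  by move=> p _; exact: cf.
exact: closed_ge.
Qed.

(** The function is
    z |-> d(x, y) / 2 * (d(z, y) - d(z, x)) / (d(z, y) + d(z, x)). By the triangle
    inequality its slope at (u, v) is at most d(x, y) divided by either of the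
    denominators, at u and at v. These are at least d(x, y), so a slope 1 makes
    both equal to d(x, y): then u and v are on the metric segment from x to y,
    where the function is d(x, y) / 2 - d(z, x). *)
Lemma segment_function x y : x != y ->
  exists h : L, [/\ molecule o x y h = 1,
    forall u v, u != v -> molecule o u v h <= 1 &
    forall u v, u != v -> molecule o u v h = 1 ->
      mdist x u + mdist u v + mdist v y = mdist x y].
Proof.
move=> xy; set D := mdist x y; have D0 : 0 < D by rewrite mdist_gt0.
pose f z := D / 2 * ((mdist z y - mdist z x) / (mdist z y + mdist z x)).
have S_ge z : D <= mdist z y + mdist z x.
  by have := metric_triangle x z y; rewrite (metric_sym x z) addrC.
have f_le u v : (f u - f v) * (mdist u y + mdist u x) <= D * mdist u v /\
                (f u - f v) * (mdist v y + mdist v x) <= D * mdist u v.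
  have := S_ge u; have := S_ge v; rewrite /f.
  have := metric_triangle v u x; have := metric_triangle u v y.
  rewrite (metric_sym v u); move: (mdist_ge0 u x) (mdist_ge0 u y).
  move: (mdist_ge0 v x) (mdist_ge0 v y).
  move: (mdist u x) (mdist u y) (mdist v x) (mdist v y) (mdist u v) => a b a' b' d.
  move=> a'0 b'0 a0 b0 bd a'd S'D SD.
  have S0 : 0 < b + a by lra.
  have S'0 : 0 < b' + a' by lra.
  have -> : D / 2 * ((b - a) / (b + a)) - D / 2 * ((b' - a') / (b' + a')) =
    D * (b * a' - a * b') / ((b + a) * (b' + a')).
    by field; rewrite !gt_eqF.
  split.
    rewrite [X in X <= _](_ : _ = D * ((b * a' - a * b') / (b' + a'))); last first.
      by field; rewrite !gt_eqF.
    by rewrite ler_pM2l// ler_pdivrMr//; nra.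
  rewrite [X in X <= _](_ : _ = D * ((b * a' - a * b') / (b + a))); last first.
    by field; rewrite !gt_eqF.
  by rewrite ler_pM2l// ler_pdivrMr//; nra.
have f_lip u v : f u - f v <= 1 * mdist u v.
  have [_] := f_le u v; have := S_ge v; have := mdist_ge0 u v; rewrite mul1r.
  move: (f u - f v) (mdist u v) (mdist v y + mdist v x) => a d S d0 SD aS.
  by rewrite leNgt; apply/negP => da; nra.
have [h hE] := Lip0_of o f_lip.
have hB u v : h u - h v = f u - f v by rewrite !hE; ring.
exists h; split=> [|u v uv|u v uv].
- rewrite moleculeE hB /f !mdistxx (metric_sym y x) -/D.
  by field; rewrite gt_eqF.
- by rewrite moleculeE hB ler_pdivrMr ?mdist_gt0.
have d0 : 0 < mdist u v by rewrite mdist_gt0.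
rewrite moleculeE hB => /(congr1 (fun t => t * mdist u v)).
rewrite divfK ?gt_eqF// mul1r => fE.
have Su : mdist u y + mdist u x = D.
  apply/eqP; rewrite eq_le S_ge andbT; have [+ _] := f_le u v.
  by rewrite fE mulrC ler_pM2r.
have Sv : mdist v y + mdist v x = D.
  apply/eqP; rewrite eq_le S_ge andbT; have [_ +] := f_le u v.
  by rewrite fE mulrC ler_pM2r.
move: fE; rewrite /f Su Sv (metric_sym x u).
have -> : D / 2 * ((mdist u y - mdist u x) / D) - D / 2 * ((mdist v y - mdist v x) / D) =
  (mdist u y - mdist u x) / 2 - (mdist v y - mdist v x) / 2.
  by field; rewrite gt_eqF.
by move: Su Sv; rewrite -/D; lra.
Qed.

Lemma free_trivial : (forall x y, x = y) -> forall mu, mu = 0.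
Proof.
move=> M1 mu; apply/eqP; rewrite -normr_le0; apply: free_norm_le => g _.
suff -> : g = 0 by rewrite -(scale0r 0) free_appZ mul0r.
apply/eqP; rewrite -normr_le0; apply: Lip0_norm_leW => // x y.
by rewrite (M1 x y) subrr mul0r.
Qed.

Lemma str_exp_trivial : (forall x y, x = y) -> str_exp (unit_ball F) 0.
Proof.
move=> M1; split; first by rewrite /unit_ball /= normr0.
exists (eval_free 0); split => [|w _ _]; last first.
  have -> : w = (fun=> 0) by apply/funext => n; exact: free_trivial.
  exact: cvg_cst.
suff -> : [set eval_free (0 : L) b | b in unit_ball F] = [set eval_free (0 : L) 0].
  by rewrite sup1.
apply/seteqP; split => [_ [b _ <-]|_ ->]; first by rewrite (free_trivial M1 b).
by exists 0 => //; rewrite /unit_ball /= normr0.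
Qed.

Context (M_compact : compact [set: M]).

Lemma pairs_compact : compact [set: M * M].
Proof. by rewrite -setXTT; exact: compact_setX. Qed.

Lemma closed_pairs_compact (A : set (M * M)) : closed A -> compact A.
Proof. by move=> cA; rewrite -[A]setTI; exact: compact_closedI pairs_compact cA. Qed.

Lemma slope_max g (A : set (M * M)) : closed A -> A !=set0 ->
  (forall p, A p -> p.1 != p.2) ->
  exists2 p, A p & forall q, A q -> molecule o q.1 q.2 g <= molecule o p.1 p.2 g.
Proof.
move=> cA A0 Ad.
have cs : {within A, continuous (fun q : M * M => molecule o q.1 q.2 g)}.
  by apply: continuous_in_subspaceT => p /set_mem/Ad; exact: slope_continuous.
have [p /set_mem Ap pmax] := compact_EVT_max A0 (closed_pairs_compact cA) cs.
by exists p => // q Aq; exact/pmax/mem_set.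
Qed.

Lemma mdist_min (A : set (M * M)) : closed A -> A !=set0 ->
  exists2 p, A p & forall q, A q -> mdist p.1 p.2 <= mdist q.1 q.2.
Proof.
move=> cA A0.
have cs : {within A, continuous (fun q : M * M => mdist q.1 q.2)}.
  by apply: continuous_subspaceT => p; exact: mdist_continuous.
have [p /set_mem Ap pmax] := compact_EVT_min A0 (closed_pairs_compact cA) cs.
by exists p => // q Aq; exact/pmax/mem_set.
Qed.

(** The pair (x, y) is one of least distance among those of slope [c], and [G]
    is the sum of [g] and of a small multiple of the function of
    [segment_function]. A pair where [G] has maximal slope has slope [c] for [g],
    so it is at least as far apart as (x, y), and it lies in order on the metric
    segment from x to y; it is therefore (x, y). *)
Lemma peak_perturbation g c r alpha x0 y0 : x0 != y0 -> 0 < r -> 0 < alpha ->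
  (forall u v, u != v -> molecule o u v g <= c) -> c <= `|g| ->
  (forall u v, u != v -> mdist u v < r -> molecule o u v g <= c - alpha) ->
  exists x y, [/\ x != y, molecule o x y g = c & exists G, peak (o := o) G x y].
Proof.
move=> xy0 r0 a0 gc cg gr.
pose K := [set p : M * M | r <= mdist p.1 p.2].
have cK : closed K by apply: closed_superlevel; exact: mdist_continuous.
have Kd p : K p -> p.1 != p.2.
  by rewrite /K /= => rp; rewrite -mdist_gt0; exact: lt_le_trans rp.
have Kslope u v : u != v -> c - alpha < molecule o u v g -> K (u, v).
  move=> uv cg'; rewrite /K /= leNgt; apply/negP => /(gr _ _ uv).
  by rewrite leNgt cg'.
have [p Kp pc] : exists2 p, K p & c <= molecule o p.1 p.2 g.
  have [K0|/set0P K0] := eqVneq K set0.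
    suff : `|g| <= c - alpha by move/(le_trans cg); rewrite leNgt gtrBl a0.
    apply: (Lip0_norm_molecule xy0) => u v uv; rewrite leNgt; apply/negP.
    by move/(Kslope _ _ uv); rewrite K0.
  have [p Kp pmax] := slope_max g cK K0 Kd; exists p => //.
  rewrite leNgt; apply/negP => pc.
  suff : `|g| <= Num.max (molecule o p.1 p.2 g) (c - alpha).
    by move/(le_trans cg); rewrite le_max leNgt pc /= leNgt gtrBl a0.
  apply: (Lip0_norm_molecule xy0) => u v uv; rewrite le_max.
  have [|/(Kslope _ _ uv)/pmax ->//] := lerP (molecule o u v g) (c - alpha).
  by rewrite orbT.
pose K1 := K `&` [set p : M * M | 0 <= (g p.1 - g p.2) - c * mdist p.1 p.2].
have K1E p' : K p' -> c <= molecule o p'.1 p'.2 g -> K1 p'.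
  move=> Kp'; rewrite moleculeE ler_pdivlMr ?mdist_gt0 ?Kd// => cp'.
  by split => //=; rewrite subr_ge0.
have cK1 : closed K1.
  apply: closedI => //; apply: closed_superlevel => q.
  apply: cvgB; first exact: increment_continuous.
  by apply: cvgM; [exact: cvg_cst|exact: mdist_continuous].
have [[x y] [Kxy /= xyc] xymin] := mdist_min cK1 (ex_intro _ p (K1E p Kp pc)).
have xy : x != y := Kd _ Kxy.
have gxy : molecule o x y g = c.
  apply/eqP; rewrite eq_le gc// moleculeE ler_pdivlMr ?mdist_gt0//.
  by rewrite -subr_ge0.
exists x, y; split => //.
have [h [hxy h1 hseg]] := segment_function xy.
(* Smaller than alpha, so that short pairs cannot reach the slope c for G. *)
pose t := alpha / 2; have t0 : 0 < t by rewrite divr_gt0.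
have ta : t < alpha by rewrite ltr_pdivrMr// ltr_pMr// ltr1n.
exists (g + t *: h).
have GE u v : molecule o u v (g + t *: h) = molecule o u v g + t * molecule o u v h.
  by rewrite free_appD free_appZ.
have th u v : u != v -> t * molecule o u v h <= t.
  by move=> uv; rewrite ger_pMr// h1.
split=> [u v uv|rho rho0].
  by rewrite !GE hxy gxy mulr1 lerD ?gc ?th.
rewrite GE hxy gxy mulr1.
have GK u v : u != v -> c < molecule o u v (g + t *: h) -> K (u, v).
  move=> uv; rewrite GE => cG; apply: (Kslope _ _ uv).
  move: cG (th u v uv); move: (molecule o u v g) (t * molecule o u v h).
  by move: ta; clear => *; lra.
pose K2 := K `&` [set p : M * M | rho <= mdist p.1 x + mdist p.2 y].
have K2N u v : K (u, v) -> ~ K2 (u, v) -> mdist u x < rho /\ mdist v y < rho.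
  move=> Kuv nK2; suff : mdist u x + mdist v y < rho.
    by have := mdist_ge0 u x; have := mdist_ge0 v y; clear => *; lra.
  by rewrite ltNge; apply/negP => ?; apply: nK2.
have [K20|/set0P K20] := eqVneq K2 set0.
  exists t => // u v uv; rewrite addrK => /(GK _ _ uv)/K2N; apply.
  by rewrite K20.
have cK2 : closed K2.
  by apply: closedI => //; apply: closed_superlevel; exact: mdist_to_pair_continuous.
have [[u1 v1] [K1uv /= far] K2max] := slope_max (g + t *: h) cK2 K20 (fun p Kp => Kd p Kp.1).
have uv1 : u1 != v1 := Kd _ K1uv.
have lt_G : molecule o u1 v1 (g + t *: h) < c + t.
  rewrite ltNge; apply/negP; rewrite GE => cG.
  have h1uv : molecule o u1 v1 h = 1.
    apply/eqP; rewrite eq_le h1// -(ler_pM2l t0) mulr1.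
    by move: cG (gc _ _ uv1); move: (molecule o u1 v1 g) (t * molecule o u1 v1 h); clear => *; lra.
  have := hseg _ _ uv1 h1uv.
  have : K1 (u1, v1).
    by apply: K1E => //=; move: cG; rewrite h1uv mulr1 lerD2r.
  move/xymin => /=; have := mdist_ge0 x u1; have := mdist_ge0 v1 y.
  by move: far; rewrite (metric_sym u1 x); clear -rho0 => *; lra.
exists (Num.min t (c + t - molecule o u1 v1 (g + t *: h))).
  by rewrite lt_min t0 subr_gt0.
move=> u v uv.
have K2m : K2 (u, v) -> molecule o u v (g + t *: h) <= molecule o u1 v1 (g + t *: h).
  exact: K2max (u, v).
rewrite -[X in _ < X -> _]/(molecule o u v (g + t *: h)); move: K2m (GK u v uv).
move: (molecule o u v (g + t *: h)) (molecule o u1 v1 (g + t *: h)) => m m1 K2m Km.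
rewrite ltrBlDr -ltrBlDl lt_min => /andP[mt mm1]; apply: K2N.
  by apply: Km; move: mt; clear => *; lra.
by move=> /K2m; rewrite leNgt; move: mm1; rewrite ltrD2l ltrN2 => ->.
Qed.

(** Slices without short molecules are given by functions to which
    [peak_perturbation] applies, and the molecule that it yields has the maximal
    value [c], so it is in the slice. *)
Lemma slice_dichotomy S : is_slice (unit_ball F) S ->
  (exists p, str_exp (unit_ball F) p /\ S p) \/
  forall delta, 0 < delta ->
    exists u v, [/\ u != v, mdist u v < delta & S (molecule o u v)].
Proof.
move=> [[b Sb] [f [alpha [a0 SE]]]].
have [[x0 [y0 xy0]]|Mtriv] := pselect (exists x y : M, x != y); last first.
  have M1 x y : x = y by apply/eqP/negPn/negP => xy; apply: Mtriv; exists x, y.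
  left; exists 0; split; first exact: str_exp_trivial.
  by rewrite -(free_trivial M1 b).
have [g fE] := dual_free_eval f.
set c := sup [set f b | b in unit_ball F] in SE.
have ub : has_ubound [set f b | b in unit_ball F].
  by exists `|g| => _ [m /= m1 <-]; rewrite fE; exact: free_app_ball.
have gc u v : u != v -> molecule o u v g <= c.
  move=> uv; apply: ub_le_sup => //; exists (molecule o u v) => //.
  exact: molecule_ball.
have cg : c <= `|g|.
  apply: ge_sup; first by exists (f 0), 0 => //=; rewrite /unit_ball /= normr0.
  by move=> _ [m /= m1 <-]; rewrite fE; exact: free_app_ball.
have [|/existsNP[r /not_implyP[r0 far]]] := pselect (forall delta, 0 < delta ->
    exists u v, [/\ u != v, mdist u v < delta & S (molecule o u v)]); first by right.
have gr u v : u != v -> mdist u v < r -> molecule o u v g <= c - alpha.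
  move=> uv uvr; rewrite leNgt; apply/negP => guv; apply: far; exists u, v.
  by split => //; rewrite SE; split; [exact: molecule_ball|rewrite fE].
have [x [y [xy gxy [G Gpeak]]]] := peak_perturbation xy0 r0 a0 gc cg gr.
left; exists (molecule o x y); split; first exact: peak_str_exp Gpeak.
by rewrite SE; split; [exact: molecule_ball|rewrite fE gxy -/c gtrBl].
Qed.

End Slices.

(** * Adding very short molecules *)

Section ShortMolecules.
Context (R : realType) (M : metricType R) (o : M).
Notation F := (lipschitz_free o).
Notation L := (Lip0 o).
Implicit Types (mu nu : F) (g h : L) (x y u v : M) (s : seq F).

(** Up to a constant, the function is max(g, g(u) + d(u, v) - d(v, .)), whose
    values at u and v are g(u) and g(u) + d(u, v). *)
Lemma steepen g u v : `|g| <= 1 -> u != v ->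
  exists g' : L, [/\ `|g'| <= 1, molecule o u v g' = - 1 &
    forall z, `|g' z - g z| <= 2 * mdist u v].
Proof.
move=> g1 uv; pose f z := Num.max (g z) (g u + mdist u v - mdist v z).
have g_lip x y : g x - g y <= mdist x y.
  by rewrite (le_trans (Lip0_lip _ _ _))// ler_piMl// mdist_ge0.
have f_lip x y : f x - f y <= 1 * mdist x y.
  rewrite mul1r lerBlDr /f ge_max; apply/andP; split.
    by rewrite -lerBlDr (le_trans _ (g_lip x y))// lerD2l lerN2 le_max lexx.
  rewrite -lerBlDl le_max; apply/orP; right.
  by have := metric_triangle v x y; lra.
have f_ge z : g z <= f z by rewrite /f le_max lexx.
have f_le z : f z <= g z + 2 * mdist u v.
  rewrite /f ge_max lerDl mulr_ge0 ?mdist_ge0//=.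
  by have := g_lip u z; have := metric_triangle u v z; lra.
have [h hE] := Lip0_of o f_lip; exists h; split.
- by apply: Lip0_norm_leW => // x y; rewrite !hE; have := f_lip x y; lra.
- rewrite moleculeE !hE.
  have -> : f u = g u by rewrite /f (metric_sym v u) addrK maxxx.
  have -> : f v = g u + mdist u v.
    rewrite /f mdistxx subr0; apply/max_idPr.
    by have := g_lip v u; rewrite (metric_sym v u); lra.
  by field; rewrite gt_eqF// mdist_gt0.
move=> z; rewrite hE; have := f_ge z; have := f_le z.
have := f_ge o; have := f_le o; rewrite Lip0_base ler_norml => *.
by apply/andP; split; lra.
Qed.

(** On the unit ball of Lip_0(M) the action of an element of F(M) is continuous
    for uniform convergence on M, since finite combinations of evaluations are
    dense. *)
Lemma free_app_pointwise mu g c : `|g| <= 1 -> c < mu g ->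
  exists2 rho, 0 < rho & forall g', `|g'| <= 1 ->
    (forall z, `|g' z - g z| <= rho) -> c < mu g'.
Proof.
move=> g1 cg; have [e e0 ->] : exists2 e, 0 < e & c = mu g - 4 * e.
  by exists ((mu g - c) / 4); [rewrite divr_gt0// subr_gt0|field].
have [n [a [x mup]]] := fdelta_span_dense mu e0.
set p := \sum_(i < n) _ in mup.
pose A := \sum_(i < n) `|a i|; have A0 : 0 < A + 1.
  by rewrite ltr_wpDl// sumr_ge0.
exists (e / (A + 1)) => [|g' g'1 gg']; first by rewrite divr_gt0.
have pE : `|p (g' - g)| <= e.
  rewrite -eval_freeE dual_sum (le_trans (ler_norm_sum _ _ _))//.
  apply: (@le_trans _ _ (\sum_(i < n) `|a i| * (e / (A + 1)))).
    apply: ler_sum => i _; rewrite dualZ normrM ler_wpM2l// eval_freeE fdeltaE.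
    exact: gg'.
  rewrite -mulr_suml mulrA ler_pdivrMr// mulrC ler_wpM2l ?(ltW e0)//.
  by rewrite -/A lerDl.
have mpE : `|(mu - p) (g' - g)| <= 2 * e.
  rewrite (le_trans (free_norm_app _ _))// mulrC.
  rewrite ler_pM// ?(ltW mup)//.
  by rewrite (le_trans (ler_normB _ _))// -[2]/(1 + 1) lerD.
have -> : mu g' = mu g + (p (g' - g) + (mu - p) (g' - g)).
  by rewrite freeB !free_appB; ring.
move: pE mpE; rewrite !ler_norml => /andP[+ _] /andP[+ _].
rewrite ltrD2l; move: e0.
by move: (p (g' - g)) ((mu - p) (g' - g)); clear => *; lra.
Qed.

(** The open conditions that a norming function of [mu] and of the opposites of
    the molecules chosen so far satisfies. *)
Definition almost_norming (e : R) s g :=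
  `|g| <= 1 /\ forall nu, nu \in s -> 1 - e < nu g.

Lemma almost_norming_pointwise e s g : almost_norming e s g ->
  exists2 rho, 0 < rho & forall g', `|g'| <= 1 ->
    (forall z, `|g' z - g z| <= rho) -> almost_norming e s g'.
Proof.
elim: s => [[g1 _]|nu s IHs [g1 gs]]; first by exists 1.
have [|r r0 rs] := IHs.
  by split => // nu' nu's; apply: gs; rewrite in_cons nu's orbT.
have [r' r'0 rnu] := free_app_pointwise g1 (gs nu (mem_head _ _)).
exists (Num.min r r') => [|g' g'1 gg']; first by rewrite lt_min r0.
have le_r : Num.min r r' <= r by rewrite ge_min lexx.
have le_r' : Num.min r r' <= r' by rewrite ge_min lexx orbT.
have {}rs := rs g' g'1 (fun z => le_trans (gg' z) le_r).
have {}rnu := rnu g' g'1 (fun z => le_trans (gg' z) le_r').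
by split => // nu'; rewrite in_cons => /orP[/eqP ->//|]; exact: rs.2.
Qed.

Lemma almost_norming_molecule e s g : 0 < e -> almost_norming e s g ->
  exists2 delta, 0 < delta & forall u v, u != v -> mdist u v < delta ->
    exists g', almost_norming e (- molecule o u v :: s) g'.
Proof.
move=> e0 gs; have [rho rho0 near] := almost_norming_pointwise gs.
exists (rho / 2) => [|u v uv uv_rho]; first by rewrite divr_gt0.
have [g' [g'1 g'uv gg']] := steepen gs.1 uv.
have [|_ g's] := near g' g'1.
  by move=> z; rewrite (le_trans (gg' z))// mulrC -ler_pdivlMr// ltW.
exists g'; split => // nu; rewrite in_cons => /orP[/eqP ->|/g's//].
by rewrite freeN g'uv opprK gtrBl.
Qed.

(** The sequence [s] lists [mu] and the opposites of the short molecules chosen so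
    far. By [almost_norming_molecule] a short enough molecule of the next slice
    can be added to it. *)
Lemma avoiding_sequence (C : set F) (S : (set F)^nat) e mu : 0 < e ->
  (forall n, (exists b, C b /\ S n b) \/
    forall delta, 0 < delta ->
      exists u v, [/\ u != v, mdist u v < delta & S n (molecule o u v)]) ->
  `|mu| = 1 ->
  exists (b : F^nat) (s : nat -> seq F), [/\
    forall n, S n (b n),
    forall n, mu \in s n,
    forall n, exists g, almost_norming e (s n) g,
    forall n m, (n <= m)%N -> {subset s n <= s m} &
    forall n, C (b n) \/ - b n \in s n.+1].
Proof.
move=> e0 CS mu1.
pose ok (s : seq F) := mu \in s /\ exists g, almost_norming e s g.
pose T := {s : seq F | ok s}.
have next (ns : nat * T) : exists bs : F * T, [/\ S ns.1 bs.1,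
    {subset sval ns.2 <= sval bs.2} & C bs.1 \/ - bs.1 \in sval bs.2].
  case: ns => n [s [mus [g gs]]] /=.
  have [[b [Cb Sb]]|loc] := CS n.
    by exists (b, exist ok s (conj mus (ex_intro _ g gs))); split => //; left.
  have [delta delta0 gd] := almost_norming_molecule e0 gs.
  have [u [v [uv duv Suv]]] := loc delta delta0.
  have s'P : ok (- molecule o u v :: s).
    by split; [rewrite in_cons mus orbT|exact: gd].
  exists (molecule o u v, exist ok _ s'P); split => //=.
    by move=> nu nus; rewrite in_cons nus orbT.
  by right; exact: mem_head.
have [f fP] := choice next.
have s0P : ok [:: mu].
  split; first exact: mem_head.
  have [g g1 gmu] := free_norm_adherent mu e0; exists g; split => // nu.
  by rewrite inE => /eqP ->; rewrite -mu1.
pose s := fix s n : T := if n is n'.+1 then (f (n', s n')).2 else exist ok _ s0P.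
exists (fun n => (f (n, s n)).1), (fun n => sval (s n)); split => [n|n|n|n m|n].
- by have [] := fP (n, s n).
- exact: (svalP (s n)).1.
- exact: (svalP (s n)).2.
- elim: m => [|m IHm]; first by rewrite leqn0 => /eqP ->.
  rewrite leq_eqVlt => /orP[/eqP ->//|/IHm nm nu /nm].
  by have [_ + _] := fP (m, s m); apply.
- by have [] := fP (n, s n).
Qed.

(** Points [nu] of the convex hull of the chosen sequence are controlled by their
    defect 1 - nu g: it bounds, up to [e], the distance of [nu] to [C], whenever
    [g] is almost norming for a sufficiently long list. This property is convex
    in [nu]. It holds for points of [C], and for the chosen molecules because
    their defect is nearly 2. Applied to a [nu] close to [mu], whose defect is
    small, it shows that [mu] is close to [C]. *)
Lemma determining_closure (C : set F) (S : (set F)^nat) mu :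
  @convex_set R F C -> C `<=` unit_ball F -> C !=set0 ->
  (forall n, S n `<=` unit_ball F) ->
  (forall n, (exists b, C b /\ S n b) \/
    forall delta, 0 < delta ->
      exists u v, [/\ u != v, mdist u v < delta & S n (molecule o u v)]) ->
  `|mu| = 1 ->
  (forall B, B `<=` unit_ball F -> (forall n, B `&` S n !=set0) ->
    closed_conv_hull B mu) ->
  closure C mu.
Proof.
move=> cC C1 [c0 Cc0] S1 CS mu1 det; apply/closureP => eps eps0.
(* The errors below add up to less than 4 e. *)
pose e := eps / 5; have e0 : 0 < e by rewrite divr_gt0.
have [b [s [Sb mus gs smono bs]]] := avoiding_sequence e0 CS mu1.
pose Q := [set nu : F | exists c N, C c /\ forall g, almost_norming e (s N) g ->
  `|nu - c| <= 1 - nu g + e].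
have s_weak n m g : (n <= m)%N -> almost_norming e (s m) g -> almost_norming e (s n) g.
  by move=> nm [g1 gsm]; split => // nu /(smono _ _ nm)/gsm.
have Qb : range b `<=` Q.
  move=> _ [n _ <-]; have b1 := S1 _ _ (Sb n).
  have [Cb|bn] := bs n.
    exists (b n), 0%N; split => // g [g1 _]; rewrite subrr normr0.
    have := le_trans (free_app_norm_le (b n) g1) b1.
    by move: (b n g) e0; clear => *; lra.
  exists c0, n.+1; split => // g [g1 /(_ _ bn)]; rewrite freeN.
  have : `|b n - c0| <= 2.
    by rewrite (le_trans (ler_normB _ _))// -[2]/(1 + 1) lerD// C1.
  by move: (b n g) `|b n - c0|; clear => *; lra.
have Qconvex : @convex_set R F Q.
  apply/convex_setP => x y t /andP[t0 t1] [c [N [Cc cN]]] [d [K [Cd dK]]].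
  exists (t *: c + (1 - t) *: d), (maxn N K); split.
    by move/convex_setP : cC; apply => //; rewrite t0.
  move=> g gNK; have xc := cN g (s_weak _ _ _ (leq_maxl _ _) gNK).
  have yd := dK g (s_weak _ _ _ (leq_maxr _ _) gNK).
  have -> : t *: x + (1 - t) *: y - (t *: c + (1 - t) *: d) =
      t *: (x - c) + (1 - t) *: (y - d).
    by rewrite !scalerBr opprD addrACA.
  rewrite (le_trans (ler_normD _ _))// !normrZ !ger0_norm ?subr_ge0//.
  rewrite freeD !freeZ.
  move: xc yd t0 t1; move: `|x - c| `|y - d| (x g) (y g); clear => a a' p q ap aq t0 t1.
  have := ler_wpM2l t0 ap; have : (1 - t) * a' <= (1 - t) * (1 - q + e).
    by rewrite ler_wpM2l// subr_ge0.
  by rewrite -/e; lra.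
have Bb : range b `<=` unit_ball F by move=> _ [n _ <-]; exact: S1 (Sb n).
have BS n : range b `&` S n !=set0 by exists (b n); split => //; exists n.
have /closureP/(_ e e0)[nu /(conv_hull_min Qconvex Qb)[c [N [Cc cN]]] mu_nu] :=
  det _ Bb BS.
exists c => //; have [g [g1 gN]] := gs N.
have nuc := cN g (conj g1 gN); have mug := gN _ (mus N).
have mu_nu_g : mu g - nu g <= `|mu - nu| by rewrite -freeB free_app_norm_le.
rewrite -(subrK nu mu) -addrA (le_lt_trans (ler_normD _ _))//.
have -> : eps = 5 * e by rewrite /e; field.
move: nuc mug mu_nu_g mu_nu e0.
by move: (mu g) (nu g) `|mu - nu| `|nu - c|; clear => *; lra.
Qed.

End ShortMolecules.

(** * Separability *)

Section SmallSlices.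
Context (R : realType) (X : normedModType R).
Implicit Types (x : X) (B : set X).

Lemma dual_ball_ubound (f : dual X) : has_ubound [set f b | b in unit_ball X].
Proof.
exists `|f| => _ [b /= b1 <-]; rewrite (le_trans (ler_norm _))//.
by rewrite (le_trans (dual_norm_app _ _))// ler_piMr.
Qed.

(** Otherwise points of the slices of width 1 / (n + 1), at distance at least [e]
    from [x], would form a maximizing sequence that does not converge to [x]. *)
Lemma str_exp_small_slice x e : str_exp (unit_ball X) x -> 0 < e ->
  exists2 T, is_slice (unit_ball X) T & forall b, T b -> `|x - b| < e.
Proof.
move=> [x1 [f [fx fsub]]] e0; apply: contrapT => H.
have /choice[w wP] : forall n : nat, exists w,
    slice (unit_ball X) f n.+1%:R^-1 w /\ e <= `|x - w|.
  move=> n; apply: contrapT => Hn; apply: H.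
  exists (slice (unit_ball X) f n.+1%:R^-1).
    split; last by exists f, n.+1%:R^-1; rewrite invr_gt0.
    by exists x; split => //; rewrite -fx gtrBl invr_gt0.
  by move=> b Tb; rewrite ltNge; apply/negP => eb; apply: Hn; exists b.
have : w @ \oo --> x.
  apply: fsub => [n|]; first by have [[]] := wP n.
  apply/cvgrPdist_lt => r r0.
  near=> n; have [[w1 wn] _] := wP n.
  have fw : f (w n) <= f x.
    by rewrite fx; apply: ub_le_sup; [exact: dual_ball_ubound|exists (w n)].
  rewrite ger0_norm ?subr_ge0// ltrBlDl -ltrBlDr.
  apply: le_lt_trans wn; rewrite -fx lerD2l lerN2; apply: ltW.
  by near: n; exact: near_infty_natSinv_lt (PosNum r0).
move=> /cvgrPdist_lt/(_ e e0)[n _ /(_ n (leqnn n))] /=.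
by have [_] := wP n; rewrite leNgt => /negbTE ->.
Unshelve. all: by end_near. Qed.

Lemma ball_is_slice : is_slice (unit_ball X) (slice (unit_ball X) 0 1).
Proof.
split; last by exists 0, 1.
exists 0; split; first by rewrite /unit_ball /= normr0.
suff -> : [set (0 : dual X) b | b in unit_ball X] = [set 0].
  by rewrite sup1 sub0r ltrN10.
apply/seteqP; split => [_ [b _ <-]//|_ ->].
by exists 0 => //; rewrite /unit_ball /= normr0.
Qed.

(** For each ball of radius 1 / (k + 1) about a point of a dense sequence, take a
    slice contained in it if there is one. Near a strongly exposed point such a
    slice exists, and then any point of the chosen slice is close to it. *)
Lemma str_exp_slices (w : X^nat) :
  (forall x e, 0 < e -> exists n, `|x - w n| < e) ->
  exists S : (set X)^nat, (forall n, is_slice (unit_ball X) (S n)) /\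
    forall B, (forall n, B `&` S n !=set0) ->
      str_exp (unit_ball X) `<=` closure B.
Proof.
move=> w_dense.
have /choice[S0 S0P] : forall p : nat * nat, exists S,
    is_slice (unit_ball X) S /\
    ((exists2 T, is_slice (unit_ball X) T &
        forall b, T b -> `|w p.1 - b| < p.2.+1%:R^-1) ->
      forall b, S b -> `|w p.1 - b| < p.2.+1%:R^-1).
  move=> p.
  have [[T sT Tw]|no] := pselect (exists2 T, is_slice (unit_ball X) T &
    forall b, T b -> `|w p.1 - b| < p.2.+1%:R^-1).
    by exists T.
  by exists (slice (unit_ball X) 0 1); split => //; exact: ball_is_slice.
pose S n := S0 (odflt (0, 0)%N (unpickle n)).
exists S; split => [n|B BS x sx]; first exact: (S0P _).1.
apply/closureP => e e0.
have [k /= ke] : exists k : nat, k.+1%:R^-1 < e / 2.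
  have e20 : 0 < e / 2 by rewrite divr_gt0.
  have [k _ /(_ k (leqnn k)) ke] := near_infty_natSinv_lt (PosNum e20).
  by exists k.
have k0 : 0 < k.+1%:R^-1 / 2 :> R by rewrite divr_gt0// invr_gt0.
have [n xn] := w_dense x _ k0.
have [T sT Tx] := str_exp_small_slice sx k0.
have wT : exists2 T, is_slice (unit_ball X) T &
    forall b, T b -> `|w n - b| < k.+1%:R^-1.
  exists T => // b /Tx xb; rewrite -(subrK x (w n)) -addrA.
  by rewrite (le_lt_trans (ler_normD _ _))// [ltRHS]splitr ltrD// distrC.
have [b [Bb Sb]] := BS (pickle (n, k)); exists b => //.
have wb : `|w n - b| < k.+1%:R^-1.
  by move: Sb; rewrite /S pickleK /= => Sb; exact: (S0P (n, k)).2 wT b Sb.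
rewrite -(subrK (w n) x) -addrA (le_lt_trans (ler_normD _ _))//.
rewrite [ltRHS]splitr ltrD ?(lt_trans wb)//.
apply: lt_trans xn _; apply: lt_trans ke.
by rewrite ltr_pdivrMr// ltr_pMr ?ltr1n// invr_gt0.
Qed.

End SmallSlices.

(** Finite nets come from the covering form of compactness, with the filter of the
    finite sequences that contain a given one. *)
Lemma compact_dense_sequence (R : realType) (M : metricType R) (o : M) :
  compact [set: M] ->
  exists d : nat -> M, forall x e, 0 < e -> exists n, mdist x (d n) < e.
Proof.
move=> /compact_near_coveringP covM.
have net e : 0 < e -> exists s : seq M, forall x, exists2 p, p \in s & mdist x p < e.
  move=> e0.
  pose G := filter_from [set: seq M] (fun s0 => [set s : seq M | {subset s0 <= s}]).
  have GF : Filter G.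
    apply: filter_from_filter; first by exists [::].
    move=> s t _ _; exists (s ++ t) => // r str.
    by split=> x xs; apply: str; rewrite mem_cat xs ?orbT.
  have [|s _ /(_ s (fun _ h => h)) sP] := covM _ G
      (fun s x => exists2 p, p \in s & mdist x p < e) GF.
    move=> x _; exists (ball x e, [set s : seq M | {subset [:: x] <= s}]).
      by split; [exact: nbhsx_ballx|exists [:: x]].
    move=> [y s] [/= + xs]; rewrite ballEmdist /= => xy.
    by exists x; [apply: xs; exact: mem_head|rewrite metric_sym].
  by exists s => x; exact: sP.
have /choice[s sP] : forall k : nat, exists s : seq M,
    forall x, exists2 p, p \in s & mdist x p < k.+1%:R^-1.
  by move=> k; apply: net; rewrite invr_gt0.
exists (fun n => let p := odflt (0, 0)%N (unpickle n) in nth o (s p.1) p.2).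
move=> x e e0; have [k _ /(_ k (leqnn k)) ke] := near_infty_natSinv_lt (PosNum e0).
have [p ps xp] := sP k x; exists (pickle (k, index p (s k))).
by rewrite pickleK /= nth_index// (lt_trans xp).
Qed.

Lemma free_dense_sequence (R : realType) (M : metricType R) (o : M) :
  compact [set: M] ->
  exists w : nat -> lipschitz_free o,
    forall mu e, 0 < e -> exists n, `|mu - w n| < e.
Proof.
move=> /(compact_dense_sequence o)[d d_dense].
pose comb (c : seq (rat * nat)) : lipschitz_free o :=
  \sum_(q <- c) ratr q.1 *: fdelta o (d q.2).
pose appr mu := forall e, 0 < e -> exists c, `|mu - comb c| < e.
have appr0 : appr 0.
  by move=> e e0; exists [::]; rewrite /comb big_nil subrr normr0.
have apprD mu nu : appr mu -> appr nu -> appr (mu + nu).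
  move=> am an e e0; have e20 : 0 < e / 2 by rewrite divr_gt0.
  have [c mc] := am _ e20; have [c' nc'] := an _ e20; exists (c ++ c').
  rewrite /comb big_cat /= opprD addrACA (le_lt_trans (ler_normD _ _))//.
  by rewrite [ltRHS]splitr ltrD.
have appr_delta a x : appr (a *: fdelta o x).
  move=> e e0; set N := `|fdelta o x|.
  have e20 : 0 < e / 2 by exact: divr_gt0.
  have N0 : 0 < N + 1 by rewrite ltr_wpDl// normr_ge0.
  have r0 : 0 < e / 2 / (N + 1) by exact: divr_gt0.
  have [q] : exists q : rat, ratr q \in `]a, (a + e / 2 / (N + 1))[.
    by apply: rat_in_itvoo; rewrite ltrDl.
  rewrite in_itv /= => /andP[aq qa]; have q0 : 0 < `|ratr q : R| + 1 by rewrite ltr_wpDl.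
  have [k xk] := d_dense x _ (divr_gt0 (divr_gt0 e0 (ltr0n _ 2)) q0).
  exists [:: (q, k)]; rewrite /comb big_seq1 /=.
  move: (ratr q : R) aq qa q0 xk => r aq qa q0 xk.
  have -> : a *: fdelta o x - r *: fdelta o (d k) =
      (a - r) *: fdelta o x + r *: (fdelta o x - fdelta o (d k)).
    by rewrite scalerBl scalerBr addrA subrK.
  rewrite (le_lt_trans (ler_normD _ _))// [ltRHS]splitr !normrZ ler_ltD//.
    rewrite -/N; apply: (@le_trans _ _ (e / 2 / (N + 1) * (N + 1))).
      apply: ler_pM; rewrite ?normr_ge0 ?lerDl// distrC ger0_norm ?subr_ge0 ?(ltW aq)//.
      by rewrite lerBlDl ltW.
    by rewrite divfK ?gt_eqF.
  apply: (@le_lt_trans _ _ ((`|r| + 1) * mdist x (d k))).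
    by apply: ler_pM; rewrite ?normr_ge0 ?lerDl ?ler01 ?fdelta_dist.
  by rewrite mulrC -ltr_pdivlMr.
exists (fun n => comb (odflt [::] (unpickle n))) => mu e e0.
have e20 : 0 < e / 2 by rewrite divr_gt0.
have [n [a [x mup]]] := fdelta_span_dense mu e20.
have ap : appr (\sum_(i < n) a i *: fdelta o (x i)).
  exact: (big_ind appr appr0 apprD (fun i _ => appr_delta (a i) (x i))).
have [c pc] := ap _ e20.
exists (pickle c); rewrite pickleK /=.
rewrite -(subrK (\sum_(i < n) a i *: fdelta o (x i)) mu) -addrA.
by rewrite (le_lt_trans (ler_normD _ _))// [ltRHS]splitr ltrD.
Qed.

(** * The equivalence *)

Section Main.
Context (R : realType) (M : metricType R) (o : M).
Context (M_compact : compact [set: M]).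
Notation F := (lipschitz_free o).

Lemma is_slice_sub (S : set F) : is_slice (unit_ball F) S -> S `<=` unit_ball F.
Proof. by move=> [_ [f [a [_ ->]]]] b []. Qed.

Lemma str_exp_sub : str_exp (unit_ball F) `<=` unit_ball F.
Proof. by move=> x []. Qed.

Lemma determining_str_exp (S : (set F)^nat) mu :
  (forall n, is_slice (unit_ball F) (S n)) -> `|mu| = 1 ->
  (forall B, B `<=` unit_ball F -> (forall n, B `&` S n !=set0) ->
    closed_conv_hull B mu) ->
  closed_conv_hull (str_exp (unit_ball F)) mu.
Proof.
move=> sS mu1 det; have S1 n : S n `<=` unit_ball F := is_slice_sub (sS n).
have dich n := slice_dichotomy M_compact (sS n).
(* Without strongly exposed points, all slices contain short molecules, and the
   argument with C reduced to 0 would make mu null. *)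
have [E0|/set0P[c0 c0E]] := eqVneq (str_exp (unit_ball F)) set0.
  have : closure [set 0] mu.
    apply: (determining_closure _ _ _ S1) mu1 det => //.
    - apply/convex_setP => x y t _ -> ->.
      by rewrite !scaler0 addr0.
    - by move=> _ ->; rewrite /unit_ball /= normr0.
    - by exists 0.
    move=> n; right; have [[p [+ _]]|//] := dich n.
    by rewrite E0.
  by move=> /closureP/(_ 1 ltr01)[_ ->]; rewrite subr0 mu1 ltxx.
apply: (determining_closure _ _ _ S1) mu1 det.
- exact: conv_hull_convex.
- exact: (conv_hull_min (@unit_ball_convex _ _) str_exp_sub).
- by exists c0; exact: sub_gen_smallest.
move=> n; have [[p [pE Sp]]|loc] := dich n; last by right.
by left; exists p; split => //; exact: sub_gen_smallest.
Qed.

Lemma sub_closed_conv_hull_str_exp :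
  exists S : (set F)^nat, (forall n, is_slice (unit_ball F) (S n)) /\
    forall B, (forall n, B `&` S n !=set0) ->
      closed_conv_hull (str_exp (unit_ball F)) `<=` closed_conv_hull B.
Proof.
have [w w_dense] := free_dense_sequence o M_compact.
have [S [sS SE]] := str_exp_slices w_dense.
exists S; split => // B /SE EB; apply: closed_conv_hull_min.
by apply: subset_trans EB _; apply: closure_subset; exact: sub_gen_smallest.
Qed.

(** The vector [t *: nu] with [0 <= t <= 1] lies between the unit vectors [nu] and
    [- nu]; the zero vector is such a multiple as soon as there is a unit
    vector. *)
Lemma sphere_to_ball (C : set F) : @convex_set R F C ->
  C 0 \/ (exists mu : F, mu != 0) -> unit_sphere F `<=` C -> unit_ball F `<=` C.
Proof.
move=> /convex_setP cC C0 SC.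
have seg (nu : F) t : `|nu| = 1 -> 0 <= t <= 1 -> C (t *: nu).
  move=> nu1 /andP[t0 t1].
  have -> : t *: nu = ((1 + t) / 2) *: nu + (1 - (1 + t) / 2) *: (- nu).
    by rewrite scalerN -scalerBl; congr (_ *: _); field.
  apply: cC; [by apply/andP; split; lra|exact: SC|].
  by apply: SC; rewrite /unit_sphere /= normrN.
move=> mu mu1; have [->|mu0] := eqVneq mu 0.
  case: C0 => [//|[nu nu0]]; rewrite -(scale0r (`|nu|^-1 *: nu)).
  by apply: seg; rewrite ?lexx ?ler01// normfZV.
have -> : mu = `|mu| *: (`|mu|^-1 *: mu).
  by rewrite scalerA divff ?normr_eq0// scale1r.
by apply: seg; [rewrite normfZV|rewrite normr_ge0 mu1].
Qed.

End Main.

Theorem theorem5p3 (R : realType) (M : metricType R) (o : M)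
    (M_compact : compact [set: M]) :
  (forall mu : lipschitz_free o, unit_sphere (lipschitz_free o) mu ->
     SCD (unit_ball (lipschitz_free o)) mu <->
     closed_conv_hull (str_exp (unit_ball (lipschitz_free o))) mu) /\
  (SCD_set (unit_ball (lipschitz_free o)) <->
   unit_ball (lipschitz_free o) =
     closed_conv_hull (str_exp (unit_ball (lipschitz_free o)))).
Proof.
set F := lipschitz_free o; have [S [sS SE]] := sub_closed_conv_hull_str_exp o M_compact.
split=> [mu mu1|].
  split=> [[_ [V [sV [_ det]]]]|muE].
    exact: determining_str_exp sV mu1 det.
  split; first by rewrite /unit_ball /= mu1.
  exists S; split => //; split=> [n|B _ BS]; last exact: SE muE.
  by split; [exact: (sS n).1|exact: is_slice_sub].
split=> [[V [sV det]]|ballE].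
  apply/seteqP; split; last exact: closed_conv_hull_ball (@str_exp_sub _ _ _).
  apply: sphere_to_ball.
  - exact/closure_convex/conv_hull_convex.
  - have [[nu nu0]|no] := pselect (exists nu : F, nu != 0); [by right; exists nu|left].
    apply: sub_closed_conv_hull; apply: str_exp_trivial => x y.
    apply/eqP/negPn/negP => xy; apply: no; exists (molecule o x y).
    have [h [hxy _ _]] := segment_function o xy.
    apply/eqP => m0; move: hxy; rewrite m0 free0 => /eqP.
    by rewrite eq_sym oner_eq0.
  move=> mu mu1; apply: (determining_str_exp M_compact sV mu1) => B B1 BV.
  by apply: (det B B1 BV); rewrite /unit_ball /= mu1.
by exists S; split => // B _ BS; rewrite {1}ballE; exact: SE.
Qed.
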